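(* Let $G$ be a finite group and let $p$ be a prime. The property that $\chi(xy)=\chi(x)\chi(y)$ for every nonidentity $p$-element $x\in G$, every nonidentity $p'$-element $y\in G$ of prime power order and every $\chi\in\mathrm{Irr}(G)$ holds if and only if $G$ is either a $p$-group, or a $p'$-group, or an abelian group, or $G$ has the following structure: (i) $G=AH$, where $A>1$ is cyclic and $H$ is either a normal Sylow $p$-subgroup of $G$ or a normal Hall $p'$-subgroup of $G$. (ii) If $C=C_H(A)$ and $D=[H,A]$, then $H=CD$ with $C$ abelian, $D\triangleleft G$ and $C\cap D=1$. (iii) The action of $A$ on $D$ is Frobenius.
   Context: $\mathrm{Irr}(G)$ denotes the set of irreducible complex characters of the finite group $G$. A $p$-element is an element whose order is a power of $p$; a $p'$-element (respectively $p'$-group) is an element (respectively finite group) whose order is not divisible by $p$. A Hall $p'$-subgroup of $G$ is a subgroup of order not divisible by $p$ whose index in $G$ is a power of $p$. $A$ is a subgroup of $G$, $C_H(A)$ is the centralizer of $A$ in $H$, and $[H,A]$ is the subgroup generated by all commutators $[h,a]$ with $h\in H$, $a\in A$. The action (by conjugation) of $A$ on $D$ is Frobenius if no nonidentity element of $A$ fixes a nonidentity element of $D$, i.e. $C_D(a)=1$ for every $1\neq a\in A$. *)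

(* Defs.v *)
From mathcomp Require Import all_boot all_order all_algebra all_fingroup.
From mathcomp Require Import all_solvable all_field all_character.
Set Implicit Arguments.
Unset Strict Implicit.
Unset Printing Implicit Defensive.
Import GroupScope.

Definition prime_power_order (gT : finGroupType) (y : gT) : Prop :=
  exists q k : nat, prime q /\ #[y] = (q ^ k)%N.

Definition chars_multiplicative (gT : finGroupType) (G : {group gT}) (p : nat)
    : Prop :=
  forall x y : gT,
    x \in G -> x != 1 -> p.-elt x ->
    y \in G -> y != 1 -> p^'.-elt y -> prime_power_order y ->
    forall i : Iirr G, ('chi[G]_i (x * y)%g = 'chi[G]_i x * 'chi[G]_i y)%R.

(* A :&: H = 1 is not required: only A * H = G is.  [semiregular D A] says
   that 'C_D[a] = 1 for every a in A with a != 1; it is vacuous for D = 1. *)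
Definition frobenius_structure (gT : finGroupType) (G : {group gT}) (p : nat)
    : Prop :=
  exists A H : {group gT},
    let C := 'C_H(A) in
    let D := [~: H, A] in
    [/\ [/\ A * H = G, A :!=: 1, cyclic A & H <| G],
        p.-Sylow(G) H \/ p^'.-Hall(G) H,
        [/\ C * D = H, abelian C, D <| G & C :&: D = 1]
      & semiregular D A].

(* Main.v *)
Require Import Defs.
From mathcomp Require Import all_boot all_order all_algebra all_fingroup.
From mathcomp Require Import all_solvable all_field all_character.
Set Implicit Arguments.
Unset Strict Implicit.
Unset Printing Implicit Defensive.
Import Order.TTheory GRing.Theory Num.Theory.
Import GroupScope.

(** Fix a nonlinear irreducible character chi, x a p-element and y a
p'-element of prime power order, both nontrivial.  Every conjugate y ^ g is
again admissible, so multiplicativity makes the average of chi (x * y ^ g)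
over g in G equal to chi x * chi y; by Schur's lemma that average is
chi x * chi y / chi 1.  As chi 1 > 1, chi x * chi y = 0
([chars_multiplicative_vanishing]).  So chi vanishes either on all nontrivial
p-elements or on all nontrivial p'-elements of prime power order, and
accordingly chi 1 is a multiple of the p-part or of the p'-part of #|G|.

These two parts are coprime with product #|G|, while chi 1 ^ 2 <= #|G|, so
the larger one cannot divide chi 1.  Hence one alternative holds for all
nonlinear chi at once: for pi = p or pi = p', depending only on #|G|, all of
them vanish on the elements of prime order outside pi
([vanishing_of_chars_multiplicative]).  This is the step that avoids any
appeal to solvability of G.

By column orthogonality all nonlinear characters vanish at y exactly when
#|'C_G[y]| <= #|G : G'| ([nonlinear_vanishingP]).  The first consequence is
that G' is a pi-group; the second, via a Frattini argument in G' <[y]>, is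
that 'C_G[y] is a complement to G' in G ([der1_cent1_compl]).  With H the
normal Hall pi-subgroup, A a complement to H, and y any element of prime order
of A, the abelian group 'C_G[y] meets H in 'C_H(A), and [~: H, A] = G' is acted
on semiregularly by A, which is therefore cyclic
([frobenius_structure_of_cent1]).

Conversely, given such a structure with D = [~: H, A], an element g outside
H has its whole coset g D in its conjugacy class, and G' is contained in D;
hence every nonlinear character vanishes at g ([card_cent1_outside_kernel]).
Exactly one of x and y lies in H, so the other one and x * y are outside H, and
both sides of the identity are 0 for nonlinear characters; linear characters
are multiplicative on all of G. *)

(** * Vanishing of nonlinear characters *)

Section Vanishing.
Local Open Scope ring_scope.
Variables (gT : finGroupType) (G : {group gT}).
Implicit Types (x y : gT) (i : Iirr G).

(** The sum of the images of the conjugates of y commutes with the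
representation, hence is scalar by Schur's lemma; its trace gives the scalar. *)
Lemma sum_irr_mul_class i x y : x \in G -> y \in G ->
  'chi_i 1%g * (\sum_(g in G) 'chi_i (x * y ^ g)%g)
     = #|G|%:R * ('chi_i x * 'chi_i y).
Proof.
move=> Gx Gy; have chiE z: z \in G -> 'chi_i z = \tr ('Chi_i z).
  by move=> Gz; rewrite -irrRepr cfunE Gz mulr1n.
have GyJ g: g \in G -> (y ^ g)%g \in G by move=> Gg; rewrite groupJ.
pose S := \sum_(g in G) 'Chi_i (y ^ g)%g.
have trS: \tr S = #|G|%:R * 'chi_i y.
  rewrite raddf_sum /= mulr_natl -sumr_const; apply: eq_bigr => g Gg.
  by rewrite -chiE ?GyJ // cfunJ.
have [a Sa]: exists a : algC, S = a%:M.
  apply/is_scalar_mxP; apply: mx_abs_irr_cent_scalar 'Chi_i _ _ _.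
    exact: groupC (socle_irr _).
  apply/centgmxP=> h Gh; rewrite mulmx_suml mulmx_sumr.
  rewrite [RHS](reindex_inj (mulIg h)) /=; apply: eq_big => g.
    by rewrite groupMr.
  move=> Gg; rewrite -!repr_mxM ?GyJ ?groupM //.
  by rewrite conjgM -conjgC.
have ->: \sum_(g in G) 'chi_i (x * y ^ g)%g = a * 'chi_i x.
  rewrite (chiE x) // -mxtraceZ -mul_mx_scalar -Sa mulmx_sumr raddf_sum.
  apply: eq_bigr => g Gg; have Gyg := GyJ g Gg.
  by rewrite chiE ?(groupM Gx Gyg) // repr_mxM.
have defa: 'chi_i 1%g * a = #|G|%:R * 'chi_i y.
  by rewrite -trS Sa mxtrace_scalar irr1_degree mulr_natl.
by rewrite mulrA defa -mulrA; congr (_ * _); rewrite mulrC.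
Qed.

(** Column orthogonality at (x, x): the linear characters, #|G : G'| in
number, contribute 1 each. *)
Lemma card_cent1_split x : x \in G ->
  #|'C_G[x]|%:R = #|G : G^`(1)%g|%:R
    + \sum_(i | 'chi[G]_i \isn't a linear_char) `|'chi_i x| ^+ 2.
Proof.
move=> Gx; have := second_orthogonality_relation x Gx.
rewrite class_refl mulr1n => <-.
rewrite (bigID (fun i => 'chi[G]_i \is a linear_char)) /=; congr (_ + _).
  rewrite -card_lin_irr -sumr_const; apply: eq_big => // i Li.
  by rewrite -normCK normC_lin_char ?expr1n.
by apply: eq_bigr => i _; rewrite normCK.
Qed.

(** The link between characters and group structure: smallness of the
centralizer is what both directions of the theorem use. *)
Lemma nonlinear_vanishingP x : x \in G ->
  reflect (forall i, 'chi[G]_i \isn't a linear_char -> 'chi_i x = 0)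
          (#|'C_G[x]| <= #|G : G^`(1)|)%N.
Proof.
move=> Gx; have ge0 i: 'chi[G]_i \isn't a linear_char -> 0 <= `|'chi_i x| ^+ 2.
  by rewrite exprn_ge0.
rewrite -(ler_nat algC) card_cent1_split //.
rewrite -[leRHS]addr0 lerD2l.
have S_ge0 := sumr_ge0 _ ge0.
apply: (iffP idP) => [leS0 i nLi | chi0].
  have /eqP: \sum_(i | 'chi[G]_i \isn't a linear_char) `|'chi_i x| ^+ 2 = 0.
    by apply/eqP; rewrite eq_le leS0 S_ge0.
  rewrite psumr_eq0 // => /allP/(_ i); rewrite mem_index_enum nLi => /(_ isT).
  by rewrite sqrf_eq0 normr_eq0 => /eqP.
by rewrite big1 // => i /chi0->; rewrite normr0 expr0n.
Qed.

(** The regular character vanishes off 1, but at such an x only the linear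
characters contribute to it, and they are all trivial on G'. *)
Lemma der1_vanishing_eq1 x : x \in G^`(1)%g ->
  (forall i, 'chi[G]_i \isn't a linear_char -> 'chi_i x = 0) -> x = 1%g.
Proof.
move=> G'x chi0; have Gx: x \in G := subsetP (der_sub 1 G) x G'x.
have := cfRegE G x; rewrite cfReg_sum sum_cfunE.
rewrite (bigID (fun i => 'chi[G]_i \is a linear_char)) /=.
rewrite [X in _ + X]big1 ?addr0 => [|i /chi0 xi0]; last first.
  by rewrite cfunE xi0 mulr0.
rewrite (eq_bigr (fun=> 1)) => [|i Li]; last first.
  rewrite cfunE lin_char1 // mul1r -(lin_char1 Li); apply: cfker1.
  by move: Li; rewrite lin_irr_der1 => /subsetP/(_ x G'x).
rewrite sumr_const card_lin_irr; case: eqP => // _ /eqP.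
by rewrite mulr0n pnatr_eq0 -leqn0 leqNgt indexg_gt0.
Qed.

(** Here the sum in [sum_irr_mul_class] is #|G| * (chi x * chi y), so that
(chi 1 - 1) * (chi x * chi y) = 0. *)
Lemma irr_mul_eq0 i x y : x \in G -> y \in G ->
    'chi[G]_i \isn't a linear_char ->
    (forall g, g \in G -> 'chi_i (x * y ^ g)%g = 'chi_i x * 'chi_i y) ->
  'chi_i x * 'chi_i y = 0.
Proof.
move=> Gx Gy nLi chiM; have := sum_irr_mul_class i Gx Gy.
rewrite (eq_bigr (fun=> 'chi_i x * 'chi_i y)) // sumr_const.
rewrite -[X in _ * X = _]mulr_natl.
rewrite mulrCA => /(mulfI (neq0CG G))/eqP.
rewrite -subr_eq0 -[X in _ - X]mul1r -mulrBl mulf_eq0 subr_eq0.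
by case/orP=> [chi1|/eqP//]; case/negP: nLi; rewrite qualifE/= irr_char.
Qed.

(** The quotient chi 1 / #|S| is the multiplicity of the principal character
in the restriction of chi to S. *)
Lemma vanishing_dvd_irr1 i (S : {group gT}) : S \subset G ->
    {in S^#, forall x, 'chi[G]_i x = 0} ->
  exists n, 'chi[G]_i 1%g = (n * #|S|)%:R.
Proof.
move=> sSG chi0; have NchiS: 'Res[S] 'chi[G]_i \is a character.
  by rewrite cfRes_char ?irr_char.
have := Cnat_cfdot_char_irr 0 NchiS; rewrite irr0 cfdotE (big_setD1 1%g) //=.
rewrite big1 ?addr0 => [|x S1x]; last first.
  by case/setD1P: (S1x) => _ Sx; rewrite cfResE // chi0 ?mul0r.
rewrite cfRes1 cfun1E group1 conjC1 mulr1 => /natrP[n def_n]; exists n.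
by rewrite natrM -def_n mulrC mulVKf ?neq0CG.
Qed.

(** If chi z were not 0, chi would vanish on all the Sylow q-subgroups with q
in rho, so the rho-part r of #|G| would divide chi 1; but then
r ^ 2 <= chi 1 ^ 2 <= #|G|, whereas r is larger than the complementary factor
of #|G|. *)
Lemma irr_vanishing_large_part i z (rho : nat_pred) :
    (#|G|`_rho^' < #|G|`_rho)%N ->
    (forall q (S : {group gT}) x, prime q -> q \in rho -> q.-Sylow(G) S ->
       x \in S^# -> 'chi[G]_i x * 'chi_i z = 0) ->
  'chi[G]_i z = 0.
Proof.
move=> lt_rho chiM; apply/eqP/contraT=> nz_z.
have [n chi1] := natrP (Cnat_irr1 i).
have dvn: (#|G|`_rho %| n)%N.
  apply/dvdn_partP=> [|q]; first exact: part_gt0.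
  rewrite /= pi_of_part ?cardG_gt0 // => /andP[/= pi_q rho_q].
  have q_pr: prime q by move: pi_q; rewrite mem_primes => /andP[].
  have [S sylS] := Sylow_exists q G.
  have [x Sx|k] := vanishing_dvd_irr1 (i := i) (pHall_sub sylS).
    have /eqP := chiM q S x q_pr rho_q sylS Sx.
    by rewrite mulf_eq0 (negPf nz_z) orbF => /eqP.
  rewrite chi1 => /eqP; rewrite eqC_nat => /eqP->.
  rewrite (card_Hall sylS) partn_part ?dvdn_mull // => r.
  by rewrite inE => /eqP->.
have n_gt0: (0 < n)%N by rewrite -(ltr_nat algC) -chi1 irr1_gt0.
suff: (#|G|`_rho ^ 2 <= #|G|)%N.
  rewrite -[leqRHS](partnC rho) ?cardG_gt0 // leq_pmul2l ?part_gt0 //.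
  by rewrite leqNgt lt_rho.
rewrite -(ler_nat algC) -irr_sum_square (bigD1 i) //=.
apply: le_trans (_ : 'chi_i 1%g ^+ 2 <= _); last first.
  by rewrite lerDl sumr_ge0 // => j _; rewrite exprn_ge0 // ltW ?irr1_gt0.
by rewrite chi1 -natrX ler_nat leq_sqr dvdn_leq.
Qed.

Lemma der1_pgroup_vanishing (pi : nat_pred) :
    (forall i y, y \in G -> prime #[y] -> #[y] \notin pi ->
       'chi[G]_i \isn't a linear_char -> 'chi_i y = 0) ->
  pi.-group G^`(1)%g.
Proof.
move=> chi0; apply/pgroupP=> q q_pr /(Cauchy q_pr)[y G'y oy].
have Gy := subsetP (der_sub 1 G) y G'y.
apply/contraT=> pi'q; suff y1: y = 1%g by rewrite -oy y1 order1 in q_pr.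
by apply: der1_vanishing_eq1 G'y _ => i; apply: chi0; rewrite ?oy.
Qed.

End Vanishing.

(** * Semiregular actions and the derived subgroup *)

Section Groups.
Variable gT : finGroupType.
Implicit Types A D G H : {group gT}.

(** A stabilizes a Sylow subgroup of D, hence acts faithfully and irreducibly
on a minimal A-invariant subgroup of it, which is elementary abelian; an
abelian group with a faithful irreducible representation is cyclic. *)
Lemma abelian_semiregular_cyclic A D :
    abelian A -> A \subset 'N(D) -> D :!=: 1 -> semiregular D A -> cyclic A.
Proof.
move=> abA nDA ntD regDA; have coDA := regular_norm_coprime nDA regDA.
have [|q q_pr q_dvd_D] := @pdivP #|D|; first by rewrite cardG_gt1.
have [Q sylQ nQA] := sol_coprime_Sylow_exists q (abelian_sol abA) nDA coDA.
have ntQ: Q :!=: 1.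
  by rewrite -cardG_gt1 (card_Hall sylQ) p_part_gt1 mem_primes q_pr cardG_gt0.
have [E minE sEQ] := minnormal_exists ntQ nQA.
have [nEA ntE /is_abelemP[r r_pr abelE]] :=
  minnormal_solvable minE sEQ (pgroup_sol (pHall_pgroup sylQ)).
have sED := subset_trans sEQ (pHall_sub sylQ).
have regEA: semiregular E A := semiregularS sED (subxx _) regDA.
have faithful_E : 'C_A(E) = 1.
  have [e Ee nte] := trivgPn _ ntE; apply/trivgP.
  have /semiregular_sym/(_ e) <- := regEA; last by rewrite !inE nte.
  by rewrite setIS // -cent_set1 centS // sub1set.
apply: mx_faithful_irr_abelian_cyclic abA.
  exact: (abelem_mx_faithful abelE ntE nEA).
exact/abelem_mx_irrP.
Qed.

(** Since <[y]> is a Sylow subgroup of the normal subgroup G' <[y]>, the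
Frattini argument gives G = G' 'N_G(<[y]>).  This normalizer centralizes y,
because its commutators with y lie in both <[y]> and G', which have coprime
orders.  The bound on #|'C_G[y]| then forces the intersection to be trivial. *)
Lemma der1_cent1_compl G y :
    y \in G -> prime #[y] -> ~~ (#[y] %| #|G^`(1)|) ->
    #|'C_G[y]| <= #|G : G^`(1)| ->
  G^`(1) * 'C_G[y] = G /\ G^`(1) :&: 'C_G[y] = 1.
Proof.
set D := G^`(1)%G; move=> Gy y_pr ndv_yD card_Cy.
have nsDG : D <| G := der_normal 1 G; have [sDG nDG] := andP nsDG.
have sYG: <[y]> \subset G by rewrite cycle_subG.
have coDY: coprime #|D| #|<[y]>| by rewrite coprime_sym -orderE prime_coprime.
pose K := (D <*> <[y]>)%G; have defK: D * <[y]> = K.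
  by rewrite /= norm_joinEr // (subset_trans sYG).
have nsKG: K <| G.
  apply: sub_der1_normal; first exact: joing_subl.
  by rewrite join_subG sDG.
have sylY: #[y].-Sylow(K) <[y]>.
  rewrite pHallE joing_subr -defK coprime_cardMg // partnM ?cardG_gt0 //.
  rewrite [(#|D|`__)%N]part_p'nat ?p'natE // mul1n -orderE.
  by rewrite part_pnat_id ?pnat_id /=.
have cN: 'N_G(<[y]>) \subset 'C_G[y].
  rewrite subsetI subsetIl -cent_cycle /=; apply/commG1P/trivgP.
  rewrite -(coprime_TIg coDY) subsetI commg_subr subsetIr andbT.
  by rewrite commgSS ?subsetIl.
have defG: D * 'C_G[y] = G.
  apply/eqP; rewrite eqEsubset mul_subG ?subsetIl //=.
  rewrite -{1}(Frattini_arg nsKG sylY) -defK -mulgA mulgS //.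
  have sYC: <[y]> \subset 'C_G[y].
    by rewrite subsetI sYG -cent_cycle -/(abelian _) cycle_abelian.
  by rewrite mul_subG.
split=> //; apply/eqP; rewrite trivg_card_le1 -(leq_pmul2l (cardG_gt0 G)) muln1.
by rewrite -{1}defG -mul_cardG -[leqRHS](Lagrange sDG) leq_pmul2l.
Qed.

Lemma semiregular_prime_order A D :
  (forall y, y \in A -> prime #[y] -> 'C_D[y] = 1) -> semiregular D A.
Proof.
move=> regP x /setD1P[ntx Ax]; apply/trivgP.
have [|q q_pr q_dvd] := @pdivP #[x]; first by rewrite order_gt1.
have xq_pr: #[x ^+ (#[x] %/ q)] = q.
  by rewrite orderXdiv ?dvdn_div // divnA // mulKn ?order_gt0.
rewrite -(regP (x ^+ (#[x] %/ q))) ?groupX ?xq_pr // setIS //.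
by apply/subsetP=> z /cent1P/commuteX cxz; apply/cent1P.
Qed.

(** The D-class of b is contained in b D, and has #|D : 'C_D[b]| = #|D|
elements. *)
Lemma class_regular_lcoset D b :
  b \in 'N(D) -> 'C_D[b] = 1 -> b ^: D = b *: D.
Proof.
move=> nDb regb; apply/eqP; rewrite eqEcard card_lcoset -index_cent1 regb.
rewrite indexg1 leqnn andbT; apply/subsetP=> _ /imsetP[d Dd ->].
by rewrite mem_lcoset conjg_mulR mulKg commgEr groupM ?memJ_norm ?groupV.
Qed.

Lemma Hall_over_der1 (pi : nat_pred) G :
  pi.-group G^`(1) ->
  exists2 H : {group gT}, pi.-Hall(G) H & G^`(1) \subset H /\ H <| G.
Proof.
move=> piD; have nsDG : G^`(1) <| G := der_normal 1 G.
have abGD : abelian (G / G^`(1)) := sub_der1_abelian (subxx _).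
have [H defH sDH nsHG] := inv_quotientN nsDG (pcore_normal pi _).
exists H => //; have nsDH := normalS sDH (normal_sub nsHG) nsDG.
rewrite -(pquotient_pHall piD nsDG nsDH).
by rewrite -defH nilpotent_pcore_Hall ?abelian_nil.
Qed.

(** Take for A a complement to the normal Hall pi-subgroup H.  For y of prime
order in A, the complement 'C_G[y] to G' is abelian, since its derived
subgroup lies in G' as well; so it centralizes A, and 'C_H(A) is its
intersection with H.  As y acts without fixed points on G', every element of
G' is a commutator with y, whence [~: H, A] = G'. *)
Lemma frobenius_structure_of_cent1 (pi : nat_pred) G :
    ~~ abelian G -> ~~ pi.-group G -> pi.-group G^`(1) ->
    (forall y, y \in G -> prime #[y] -> #[y] \notin pi ->
       #|'C_G[y]| <= #|G : G^`(1)|) ->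
  exists A H : {group gT},
    [/\ [/\ A * H = G, A :!=: 1, cyclic A & H <| G], pi.-Hall(G) H,
        [/\ 'C_H(A) * [~: H, A] = H, abelian 'C_H(A), [~: H, A] <| G
          & 'C_H(A) :&: [~: H, A] = 1]
      & semiregular [~: H, A] A].
Proof.
move=> nabG npiG; set D := G^`(1)%G => piD cardC.
have nsDG : D <| G := der_normal 1 G; have [sDG nDG] := andP nsDG.
have ntD : D :!=: 1 by apply: contra nabG => /eqP/derG1P.
have [H hallH [sDH nsHG]] := Hall_over_der1 piD; have [sHG nHG] := andP nsHG.
have /splitsP[A /complP[tiHA defG]] :=
  SchurZassenhaus_split (pHall_Hall hallH) nsHG.
have sAG : A \subset G by rewrite -defG mulG_subr.
have abA : abelian A.
  rewrite (isog_abelian (quotient_isog (subset_trans sAG nHG) tiHA)).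
  by rewrite (abelianS (quotientS _ sAG)) // sub_der1_abelian.
have pi'A : pi^'.-group A.
  by case/and3P: hallH => _ _; rewrite -divgS // -defG TI_cardMg // mulKn.
have ntA : A :!=: 1.
  by apply: contraNneq npiG => A1; rewrite -defG A1 mulg1 (pHall_pgroup hallH).
have complC y : y \in A -> prime #[y] -> D * 'C_G[y] = G /\ D :&: 'C_G[y] = 1.
  move=> Ay y_pr; have Gy := subsetP sAG y Ay.
  have pi'y : #[y] \in pi^' := pgroupP pi'A _ y_pr (order_dvdG Ay).
  apply: der1_cent1_compl => //; last exact: cardC.
  by apply: contraL pi'y => /(pgroupP piD _ y_pr); rewrite !inE negbK.
have regDA : semiregular D A.
  apply: semiregular_prime_order => y Ay y_pr.
  by have [_ <-] := complC y Ay y_pr; rewrite setIA (setIidPl sDG).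
have [|q q_pr /(Cauchy q_pr)[y Ay oy]] := @pdivP #|A|.
  by rewrite cardG_gt1.
have [defDC tiDC] := complC y Ay (etrans (f_equal _ oy) q_pr).
have sAC : A \subset 'C_G[y] by rewrite subsetI sAG sub_cent1 (subsetP abA).
have abC : abelian 'C_G[y].
  apply/derG1P/trivgP; rewrite -tiDC subsetI der_sub andbT.
  exact/dergS/subsetIl.
have defC : 'C_H(A) = H :&: 'C_G[y].
  apply/eqP; rewrite eqEsubset; apply/andP; split; last first.
    by apply: setIS; apply: centsS sAC _.
  apply/subsetP=> z /setIP[Hz /centP cAz].
  by rewrite !in_setI Hz (subsetP sHG) //=; apply/cent1P/cAz.
have defD : [~: H, A] = D.
  apply/eqP; rewrite eqEsubset {1}/D /= commgSS //=.
  apply/subsetP=> d Dd; have nDy : y \in 'N(D).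
    exact: subsetP nDG y (subsetP sAG y Ay).
  have: y * d \in y ^: D.
    rewrite class_regular_lcoset ?mem_lcoset ?mulKg //.
    by rewrite -tiDC setIA (setIidPl sDG).
  case/imsetP=> e De; rewrite conjg_mulR => /mulgI->.
  by rewrite -groupV invg_comm mem_commg // (subsetP sDH).
exists A, H; rewrite defD; split=> //.
  split=> //; last exact: abelian_semiregular_cyclic (subset_trans sAG nDG) _ _.
  by rewrite normC ?defG // (subset_trans sAG).
rewrite defC; split=> //; last by rewrite setIC -tiDC setIA (setIidPl sDH).
  rewrite (group_modr _ sDH) normC ?defDC ?(setIidPl sHG) //.
  by rewrite (subset_trans _ nDG) ?subsetIl.
exact: abelianS (subsetIr _ _) abC.
Qed.

(** Write g = a * c * d with a in A, c in C = 'C_H(A), d in D = [~: H, A].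
Then b = a * c is conjugate to g by an element of D and its class contains
b D, provided 'C_D[b] = 1.  This reduces to semiregularity of A, since b has a
nontrivial power in A: c is a pi-element commuting with a, and a is not a
pi-element because it is outside H. *)
Lemma card_cent1_outside_kernel (pi : nat_pred) A G H g :
    A * H = G -> abelian A -> H <| G -> pi.-Hall(G) H ->
    'C_H(A) * [~: H, A] = H ->
    abelian 'C_H(A) -> [~: H, A] <| G -> semiregular [~: H, A] A ->
  g \in G -> g \notin H -> #|'C_G[g]| <= #|G : G^`(1)|.
Proof.
move=> defG abA nsHG hallH; pose C := 'C_H(A)%G; pose D := [~: H, A]%G.
rewrite -[[~: H, A]]/(gval D) -['C_H(A)]/(gval C) => defH abC nsDG regDA.
move=> Gg H'g; have [sDG nDG] := andP nsDG.
have sAG : A \subset G by rewrite -defG mulG_subl.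
have sHG : H \subset G := pHall_sub hallH.
have cAC : C \subset 'C(A) := subsetIr _ _.
have abB : abelian (A <*> C) by rewrite abelianY abA abC /= subsetIr.
have defB : A <*> C = A * C by rewrite cent_joinEr.
have sDG' : G^`(1) \subset D.
  rewrite der1_min // -defG -defH mulgA -defB quotientMidr.
  exact: quotient_abelian.
have: g \in A * C * D by rewrite -mulgA defH defG.
case/mulsgP=> _ d /mulsgP[a c Aa Cc ->] Dd def_g.
have Hc : c \in H by case/setIP: Cc.
have Ha : a \notin H.
  apply: contra H'g => Ha; rewrite def_g !groupM //.
  by rewrite -defH (subsetP (mulG_subr _ _)).
have cac : commute a c by apply/commute_sym; apply: (centP (subsetP cAC c Cc)).
have reg_b : 'C_D[a * c] = 1.
  pose n := #[c]; have Abn : (a * c) ^+ n = a ^+ n.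
    by rewrite expgMn // expg_order mulg1.
  apply/trivgP; rewrite -(regDA (a ^+ n)).
    rewrite setIS // -Abn; apply/subsetP=> z /cent1P/commuteX cxz.
    exact/cent1P.
  rewrite !inE groupX // andbT; apply: contra Ha; rewrite -order_dvdn => dvd_an.
  rewrite (mem_normal_Hall hallH) ?(subsetP sAG) // /p_elt (pnat_dvd dvd_an) //.
  exact: mem_p_elt (pHall_pgroup hallH) Hc.
have [Ga Gc] := (subsetP sAG a Aa, subsetP sHG c Hc).
have nDb : a * c \in 'N(D) by rewrite (subsetP nDG) // groupM.
have: g \in (a * c) ^: D.
  by rewrite class_regular_lcoset // def_g mem_lcoset mulKg.
case/imsetP=> e De ->; have Ge := subsetP sDG e De.
have -> : #|'C_G[(a * c) ^ e]| = #|'C_G[a * c]|.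
  by rewrite cent1J -{1}(conjGid Ge) -conjIg cardJg.
have: #|(a * c) ^: D| <= #|(a * c) ^: G| by rewrite subset_leq_card ?classS.
rewrite class_regular_lcoset // card_lcoset -index_cent1 => leD.
rewrite -(leq_pmul2r (cardG_gt0 G^`(1)%G)) [leqRHS]mulnC Lagrange ?der_sub //.
rewrite -(Lagrange (subsetIl G 'C[a * c])) leq_pmul2l ?cardG_gt0 //.
exact: leq_trans (subset_leq_card sDG') leD.
Qed.

End Groups.

(** * Multiplicative characters *)

Lemma p_elt_prime_power_order (gT : finGroupType) (q : nat) (x : gT) :
  prime q -> q.-elt x -> prime_power_order x.
Proof. by move=> q_pr /p_natP[k ox]; exists q, k. Qed.

Lemma prime_order_neq1 (gT : finGroupType) (x : gT) : prime #[x] -> x != 1.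
Proof. by rewrite -order_gt1 => /prime_gt1. Qed.

Lemma chars_multiplicative_vanishing (gT : finGroupType) (G : {group gT}) p :
    chars_multiplicative G p ->
  forall i x y, ('chi[G]_i \isn't a linear_char)%R ->
    x \in G -> x != 1 -> p.-elt x ->
    y \in G -> y != 1 -> p^'.-elt y -> prime_power_order y ->
  ('chi_i x * 'chi_i y = 0)%R.
Proof.
move=> multG i x y nLi Gx ntx px Gy nty p'y [q [k [q_pr oy]]].
apply: irr_mul_eq0 => // g Gg; rewrite multG ?groupJ ?conjg_eq1 //.
- by rewrite cfunJ.
- by rewrite /p_elt orderJ.
by exists q, k; rewrite orderJ.
Qed.

(** The choice of pi depends on which of the p-part and the p'-part of #|G|
is larger, so it serves all characters simultaneously; the parts are coprime,
and equal only for the trivial group. *)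
Lemma vanishing_of_chars_multiplicative (gT : finGroupType) (G : {group gT}) p :
    prime p -> ~~ abelian G -> chars_multiplicative G p ->
  exists2 pi : nat_pred, pi = p \/ pi = p^' &
    forall i y, y \in G -> prime #[y] -> #[y] \notin pi ->
      ('chi[G]_i \isn't a linear_char -> 'chi_i y = 0)%R.
Proof.
move=> p_pr nabG multG; have vanG := chars_multiplicative_vanishing multG.
have [lt_p'p|lt_pp'|eq_pp'] := ltngtP #|G|`_p^' #|G|`_p.
- exists p; first by left.
  move=> i y Gy y_pr p'y nLi.
  apply: irr_vanishing_large_part lt_p'p _ => q S x _ /eqnP-> sylS.
  case/setD1P=> ntx Sx; apply: vanG => //.
  + exact: subsetP (pHall_sub sylS) x Sx.
  + exact: mem_p_elt (pHall_pgroup sylS) Sx.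
  + exact: prime_order_neq1.
  + by rewrite /p_elt pnatE.
  by exists #[y], 1%N; rewrite expn1.
- exists p^'; first by right.
  move=> i y Gy y_pr; rewrite inE negbK => /eqnP oy nLi.
  apply: (irr_vanishing_large_part (rho := p^')) => [|q S x q_pr p'q sylS].
    by rewrite partnNK.
  case/setD1P=> ntx Sx; rewrite mulrC.
  have qx : q.-elt x := mem_p_elt (pHall_pgroup sylS) Sx.
  apply: vanG => //.
  + exact: prime_order_neq1.
  + by rewrite /p_elt oy pnat_id.
  + exact: subsetP (pHall_sub sylS) x Sx.
  + by apply: sub_in_pnat qx => r _ /eqnP->.
  exact: p_elt_prime_power_order qx.
case/negP: nabG; suff /eqP/card1_trivg-> : #|G| == 1%N by apply: abelian1.
have := coprime_partC p #|G| #|G|; rewrite eq_pp' /coprime gcdnn => /eqP p1.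
by rewrite -(partnC p (cardG_gt0 G)) eq_pp' p1.
Qed.

Theorem theorem3p2 (gT : finGroupType) (G : {group gT}) (p : nat)
    (p_prime : prime p) :
  chars_multiplicative G p <->
  [\/ p.-group G, p^'.-group G, abelian G | frobenius_structure G p].
Proof.
split=> [multG | strG].
  have [abG|nabG] := boolP (abelian G); first by constructor 3.
  have [pG|npG] := boolP (p.-group G); first by constructor 1.
  have [p'G|np'G] := boolP (p^'.-group G); first by constructor 2.
  have [pi def_pi chi0] := vanishing_of_chars_multiplicative p_prime nabG multG.
  have npiG : ~~ pi.-group G by case: def_pi => ->.
  have [y Gy y_pr pi'y|A [H [? hallH ? ?]]] :=
    frobenius_structure_of_cent1 nabG npiG (der1_pgroup_vanishing chi0).
    by apply/nonlinear_vanishingP=> // i; apply: chi0.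
  constructor 4; exists A, H; split=> //.
  by case: def_pi hallH => ->; [left | right].
move=> x y Gx ntx px Gy nty p'y _ i.
have [/lin_charM-> //|nLi] := boolP ('chi[G]_i \is a linear_char)%R.
case: strG => [pG|p'G|/char_abelianP abG|].
- case/negP: nty; rewrite -order_eq1.
  by apply/eqP/(pnat_1 (mem_p_elt pG Gy) p'y).
- case/negP: ntx; rewrite -order_eq1.
  by apply/eqP/(pnat_1 px (mem_p_elt p'G Gx)).
- by rewrite abG in nLi.
case=> A [H [[defG _ cycA nsHG] hallH [defH abC nsDG _] regDA]].
have chi0 z (pi : nat_pred) :
    pi.-Hall(G) H -> z \in G -> z \notin H -> ('chi_i z = 0)%R.
  move=> hallH_pi Gz H'z; apply: (nonlinear_vanishingP Gz _ i nLi).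
  exact: (card_cent1_outside_kernel defG (cyclic_abelian cycA) nsHG hallH_pi
            defH abC nsDG regDA Gz H'z).
have notH (pi : nat_pred) z : pi.-Hall(G) H -> z \in G -> z != 1 ->
    pi^'.-elt z -> z \notin H.
  move=> hallH_pi Gz ntz pi'z; apply: contra ntz => Hz; rewrite -order_eq1.
  by apply/eqP/(pnat_1 (mem_p_elt (pHall_pgroup hallH_pi) Hz) pi'z).
case: hallH => hallH.
  have H'y := notH _ y hallH Gy nty p'y.
  have Hx : x \in H by rewrite (mem_normal_Hall hallH).
  rewrite (chi0 _ _ hallH Gy) // mulr0.
  by rewrite (chi0 _ _ hallH) ?(groupM Gx Gy) ?(groupMl y Hx).
have p''x : p^'^'.-elt x by rewrite /p_elt pnatNK.
have H'x := notH _ x hallH Gx ntx p''x.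
have Hy : y \in H by rewrite (mem_normal_Hall hallH).
rewrite (chi0 _ _ hallH Gx) // mul0r.
by rewrite (chi0 _ _ hallH) ?(groupM Gx Gy) ?(groupMr x Hy).
Qed.
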